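(* Let $d$ be a positive integer, let $k\in\{1,\ldots,d\}$, and set $m(k,d)=\max\{d+1,\,2(d-k+1)\}$. Let $\mathcal{C}$ be a finite family of convex sets in $\mathbb{R}^d$. If $\bigcap \mathcal{C}^*$ contains a $k$-dimensional cone for every subfamily $\mathcal{C}^*\subset \mathcal{C}$ of size at most $m(k,d)$, then $\bigcap \mathcal{C}$ contains a $k$-dimensional cone.
   Context: A cone with apex $u\in\mathbb{R}^d$ and generator set $V\subset\mathbb{R}^d$ is the set of all points of the form $u+\sum_{v\in W}\alpha(v)v$, where $W\subset V$ is finite and $\alpha(v)\ge 0$ for every $v\in W$. The apex is an arbitrary point of $\mathbb{R}^d$ (not necessarily the origin), and different subfamilies may have cones with different apexes. The dimension of a cone is the dimension of its affine hull. For a family $\mathcal{F}$ of sets, $\bigcap\mathcal{F}$ denotes the intersection of all members of $\mathcal{F}$. *)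

(* Defs.v *)
From HB Require Import structures.
From mathcomp Require Import all_boot all_order all_algebra.
From mathcomp Require Import finmap.
From mathcomp Require Import boolp classical_sets functions cardinality reals convex.

Set Implicit Arguments.
Unset Strict Implicit.
Unset Printing Implicit Defensive.

Import Order.TTheory GRing.Theory Num.Theory.

Local Open Scope classical_set_scope.
Local Open Scope ring_scope.

Definition cone (R : realType) (d : nat) (u : 'rV[R]_d) (V : set 'rV[R]_d) :
    set 'rV[R]_d :=
  [set x | exists (W : {fset 'rV[R]_d}) (alpha : 'rV[R]_d -> R),
    [/\ [set` W] `<=` V,
        forall v, v \in W -> 0 <= alpha v &
        x = u + \sum_(v <- W) alpha v *: v]].

Definition affine_hull (R : realType) (d : nat) (A : set 'rV[R]_d) :
    set 'rV[R]_d :=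
  [set x | exists (W : {fset 'rV[R]_d}) (t : 'rV[R]_d -> R),
    [/\ [set` W] `<=` A,
        \sum_(v <- W) t v = 1 &
        x = \sum_(v <- W) t v *: v]].

(* A relation rather than a function: the empty set has no dimension here. *)
Definition has_dim (R : realType) (d : nat) (A : set 'rV[R]_d) (k : nat) : Prop :=
  exists (p : 'rV[R]_d) (L : {vspace 'rV[R]_d}),
    affine_hull A = [set p + v | v in [set` L]] /\ \dim L = k.

Definition contains_cone (R : realType) (d k : nat) (S : set 'rV[R]_d) : Prop :=
  exists (u : 'rV[R]_d) (V : set 'rV[R]_d),
    has_dim (cone u V) k /\ cone u V `<=` S.

(* The subtraction is exact for k <= d. *)
Definition helly_number (k d : nat) : nat := maxn d.+1 (2 * (d - k + 1)).

(* Main.v *)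
Require Import Defs.
From HB Require Import structures.
From mathcomp Require Import all_boot all_order all_algebra.
From mathcomp Require Import finmap.
From mathcomp Require Import boolp classical_sets functions cardinality reals convex.
From mathcomp Require Import interval_inference filter topology normedtype sequences.
From mathcomp Require Import ring lra zify.

(** By induction on the number n of sets it is enough to treat n sets A_j with
    n > max(d + 1, 2 (d - k + 1)), for which the intersection of all sets but A_i
    contains a k-dimensional simplicial cone u_i + K_i, for every i
    (critical_family). Since n >= d + 2, Radon's theorem gives a point in the
    intersection Q of all sets; let q be a relative interior point of Q
    (radon_point, relative_interior_point).

    Suppose that the recession directions of Q at q span a space of dimension
    k0 < k, and work modulo this space, in dimension d' = d - k0. Choose v_i in
    K_i such that any k' = k - k0 of them remain independent in the quotient
    (kwise_independent). Radon's argument, applied to the points u_i + t v_i,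
    turns each linear dependency modulo the recession space into a point of Q:
    the two sides of the dependency agree after a correction by recession
    directions, and each A_j contains the side that does not use the index j
    (positive_side_in_member). Now let t go to infinity. The spaces of
    dependencies have dimension at least n - d', and by compactness subspaces of
    dimension n - d' have a limit Lambda of that dimension (kernel_limit). The
    points of Q divided by t tend to recession directions (recession_limit), and
    these vanish in the quotient. So for every lambda in Lambda the positive part
    alone is already a dependency: sum_i lambda_i^+ v_i = 0 in the quotient.

    This is a very strong condition on Lambda, because lambda |-> lambda_i^+ has
    a kink where lambda_i changes sign. Comparing both sides of such a wall shows
    that the indices whose coordinate functions on Lambda are proportional to a
    given one carry a dependency of their own, hence that there are at least
    k' + 1 of them (blocks_card). As Lambda has dimension l = n - d', there are l
    disjoint such blocks and l (k' + 1) <= n. Together with l >= 2 and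
    n >= 2 (d' - k' + 1) + 1 this is a contradiction.

    The closures of the sets can have a much larger intersection than the sets
    themselves. This is why recession directions are taken at a relative interior
    point of Q, where they agree with those of the closure of Q. *)

Set Implicit Arguments.
Unset Strict Implicit.
Unset Printing Implicit Defensive.

Import Order.TTheory GRing.Theory Num.Theory.
Import numFieldNormedType.Exports.

Local Open Scope ring_scope.

(** * General position and linear dependencies *)

(** A vector space over an infinite field is not a finite union of hyperplanes.
    The moment curve (1, s, s^2, ...) gives a vector off the hyperplanes that is
    moreover positive: each hyperplane meets it in the roots of a nonzero
    polynomial in s. *)
Lemma positive_avoiding (R : realFieldType) (T : finType) (k : nat)
    (phi : T -> 'cV[R]_k) :
  (forall P, phi P != 0) ->
  exists c : 'rV[R]_k, (forall j, 0 < c 0 j) /\ forall P, c *m phi P != 0.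
Proof.
move=> phi0.
pose p P : {poly R} := \sum_(j < k) phi P j 0 *: 'X^j.
have pE P s : (p P).[s] = ((\row_j s ^+ j) *m phi P) 0 0.
  rewrite horner_sum mxE; apply: eq_bigr => j _.
  by rewrite hornerZ hornerXn !mxE mulrC.
have p0 P : p P != 0.
  have /cV0Pn [j pj] := phi0 P.
  apply/negP => /eqP /(congr1 (fun q : {poly R} => q`_j)).
  rewrite coef0 coef_sum (bigD1 j) //= coefZ coefXn eqxx mulr1 big1 ?addr0.
    by move=> /eqP; rewrite (negPf pj).
  by move=> i ij; rewrite coefZ coefXn eq_sym (inj_eq val_inj) (negPf ij) mulr0.
pose q := \prod_P p P.
have q0 : q != 0 by apply/prodf_neq0 => P _.
pose rs := [seq i.+1%:R | i <- iota 0 (size q)] : seq R.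
have rsu : uniq rs.
  rewrite map_inj_uniq ?iota_uniq // => i j /eqP.
  by rewrite eqr_nat => /eqP[].
have /allPn [s sin sr] : ~~ all (root q) rs.
  apply/negP => ar; have := max_poly_roots q0 ar rsu.
  by rewrite size_map size_iota ltnn.
have s0 : 0 < s by case/mapP: sin => i _ ->; rewrite ltr0n.
exists (\row_j s ^+ j); split=> [j|P]; first by rewrite mxE exprn_gt0.
apply: contra sr => /eqP e; rewrite /root /q horner_prod.
by apply/prodf_eq0; exists P => //; rewrite pE e mxE.
Qed.

(** General position inside cones. The points are chosen one after the other:
    the i-th one has to avoid the spans of fewer than r earlier points, which
    are proper subspaces of the span of the i-th cone, so positive coefficients
    outside of all of them exist. *)
Lemma kwise_independent (R : realFieldType) (n k d r : nat)
    (G : 'I_n -> 'M[R]_(k, d)) :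
  (forall i, r <= \rank (G i))%N ->
  exists c : 'I_n -> 'rV[R]_k, (forall i j, 0 < c i 0 j) /\
    forall lam : 'rV[R]_n, lam != 0 ->
      \sum_i lam 0 i *: (c i *m G i) = 0 ->
      (r < #|[set i | lam 0%R i != 0%R]|)%N.
Proof.
move=> rG.
suff H m : exists c : 'I_n -> 'rV[R]_k, (forall i j, 0 < c i 0 j) /\
    forall lam : 'rV[R]_n, lam != 0 -> (forall i : 'I_n, (m <= i)%N -> lam 0 i = 0) ->
      \sum_i lam 0 i *: (c i *m G i) = 0 ->
      (r < #|[set i | lam 0%R i != 0%R]|)%N.
  have [c [c0 cP]] := H n; exists c; split=> // lam l0 lE; apply: cP => // i.
  by rewrite leqNgt ltn_ord.
elim: m => [|m [c [c0 cP]]].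
  exists (fun _ => const_mx 1); split=> [i j|lam /rV0Pn [i] /negP li lz].
    by rewrite mxE ltr01.
  by case: li; rewrite lz.
case: (ltnP m n) => [mn|nm]; last first.
  exists c; split=> // lam l0 lz; apply: cP => // i mi.
  by have := leq_trans nm mi; rewrite leqNgt ltn_ord.
pose i0 := Ordinal mn.
pose Z (P : {set 'I_n}) := (\sum_(i in P) <<c i *m G i>>)%MS.
pose T := {P : {set 'I_n} | (#|P| < r)%N}.
have rZ (P : {set 'I_n}) : (\rank (Z P) <= #|P|)%N.
  rewrite -sum1_card /Z; elim/big_rec2: _ => [|i s A _ IH].
    by rewrite mxrank0.
  apply: leq_trans (mxrank_adds_leqif _ _) _.
  by rewrite leq_add // mxrank_gen rank_leq_row.
(* the span of the chosen points of P misses some element of the i0-th cone *)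
have Zn (P : T) : exists j, col j (G i0 *m cokermx (Z (val P))) != 0.
  have /negP nP : ~~ (G i0 <= Z (val P))%MS.
    apply/negP => /mxrankS h.
    have := leq_trans (rG i0) (leq_trans h (rZ _)).
    by rewrite leqNgt (valP P).
  apply/existsP; rewrite -negb_forall; apply/negP => /forallP h.
  apply: nP; rewrite submxE; apply/eqP/matrixP => a b.
  by have /eqP/colP/(_ a) := h b; rewrite !mxE.
have [x [x0 xP]] := positive_avoiding (fun P : T => xchooseP (Zn P)).
pose c' i := if i == i0 then x else c i.
exists c'; split=> [i j|lam l0 lz lE]; first by rewrite /c'; case: ifP.
have [l00|l00] := eqVneq (lam 0 i0) 0.
  apply: cP => // [i|].
    rewrite leq_eqVlt => /orP[/eqP mi|/lz //].
    by rewrite -l00; congr (lam 0 _); apply: val_inj; rewrite /= mi.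
  rewrite -[RHS]lE; apply: eq_bigr => i _; rewrite /c'.
  by case: eqP => [->|//]; rewrite l00 !scale0r.
rewrite ltnNge; apply/negP => sr.
pose S := [set i | lam 0 i != 0].
have i0S : i0 \in S by rewrite inE.
have PT : (#|S :\ i0| < r)%N by rewrite (cardsD1 i0) i0S in sr.
pose P : T := exist _ (S :\ i0) PT.
have /negP[] := xP P; rewrite colE mulmxA (mulmxA x).
suff : (x *m G i0 <= Z (S :\ i0))%MS.
  by rewrite submxE => /eqP e; rewrite [_ *m cokermx _]e mul0mx.
move: lE; rewrite (bigD1 i0) //= {1}/c' eqxx => /eqP.
rewrite addr_eq0 => /eqP /(congr1 (fun v => (lam 0 i0)^-1 *: v)).
rewrite scalerA mulVf // scale1r => ->.
rewrite scalemx_sub // eqmx_opp.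
apply: summx_sub => i ii0; rewrite /c' (negPf ii0).
have [->|li] := eqVneq (lam 0 i) 0; first by rewrite scale0r sub0mx.
rewrite scalemx_sub // -(genmxE (c i *m G i)).
by apply: (sumsmx_sup i) => //; rewrite !inE ii0.
Qed.

(** The two sides of a linear dependency lam are posmx lam and posmx (- lam). *)
Definition posmx (R : realDomainType) (m n : nat) (A : 'M[R]_(m, n)) :=
  map_mx (Num.max 0) A.

Lemma posmx_ge0 (R : realDomainType) (m n : nat) (A : 'M[R]_(m, n)) i j :
  0 <= posmx A i j.
Proof. by rewrite mxE le_max lexx. Qed.

Lemma posmxB (R : realDomainType) (m n : nat) (A : 'M[R]_(m, n)) :
  posmx A - posmx (- A) = A.
Proof.
apply/matrixP => i j; rewrite !mxE.
by case: (lerP 0 (A i j)) => h;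
  [rewrite max_l ?subr0 // oppr_le0|rewrite max_r ?add0r ?opprK // oppr_ge0 ltW].
Qed.

(** The map c |-> sum_j (c L)_j^+ z_j is piecewise linear, and it vanishes
    identically. Its second difference across the wall where the a-th coordinate
    of c is zero must therefore vanish, and at a generic point of that wall only
    the columns of L proportional to the a-th unit vector contribute to it. Hence
    the rows z_j of such a block of columns are linearly dependent, so that the
    block has more than k elements; the blocks for different a are disjoint. *)
Lemma blocks_card (R : realFieldType) (l n d k : nat) (L : 'M[R]_(l, n))
    (f : 'I_l -> 'I_n) (z : 'M[R]_(n, d)) :
  colsub f L = 1%:M ->
  (forall c : 'rV_l, posmx (c *m L) *m z = 0) ->
  (forall lam : 'rV_n, lam != 0 -> lam *m z = 0 ->
     (k < #|[set j | lam 0%R j != 0%R]|)%N) ->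
  (l * k.+1 <= n)%N.
Proof.
move=> Lf Lz zk.
have LfE a b : L a (f b) = (a == b)%:R.
  by have /matrixP/(_ a b) := Lf; rewrite !mxE.
pose P a := [set j | (L a j != 0) && [forall b, (b != a) ==> (L b j == 0)]].
suff kP a : (k < #|P a|)%N.
  have tP : (\sum_a #|P a| <= n)%N.
    have -> : (\sum_a #|P a| = \sum_a \sum_(j | j \in P a) 1)%N.
      by apply: eq_bigr => a _; rewrite sum1_card.
    under eq_bigr do rewrite big_mkcond /=.
    rewrite exchange_big /=.
    apply: (@leq_trans (\sum_(j < n) 1)%N); last by rewrite sum1_card card_ord.
    apply: leq_sum => j _.
    case: (pickP (fun a => j \in P a)) => [a ja|nj]; last first.
      by rewrite big1 // => a _; rewrite nj.
    rewrite (bigD1 a) //= ja big1 ?addn0 // => b ba.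
    case: ifP => //; rewrite !inE => /andP[Lb _].
    move: ja; rewrite !inE => /andP[_ /forallP/(_ b)].
    by rewrite ba (negPf Lb).
  apply: leq_trans tP.
  have -> : (l * k.+1 = \sum_(a < l) k.+1)%N by rewrite sum_nat_const card_ord.
  by apply: leq_sum.
(* a vector of the row space on the wall, generic otherwise *)
pose T := {j : 'I_n | [exists b, (b != a) && (L b j != 0)]}.
pose phi (j : T) : 'cV[R]_l := \col_b (if b == a then 0 else L b (val j)).
have [|c [_ cP]] := @positive_avoiding R T l phi.
  move=> [j Tj]; have /existsP[b /andP[ba Lb]] := Tj; apply/cV0Pn; exists b.
  by rewrite mxE (negPf ba).
pose c' : 'rV[R]_l := \row_b (if b == a then 0 else c 0 b).
pose lam := c' *m L.
have lamE j : lam 0 j = \sum_b (if b == a then 0 else c 0 b * L b j).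
  by rewrite mxE; apply: eq_bigr => b _; rewrite mxE; case: eqP; rewrite ?mul0r.
have lam0 j : (lam 0 j == 0) = [forall b, (b != a) ==> (L b j == 0)].
  apply/eqP/forallP => [lj b|h].
    apply/implyP => ba; apply/negPn/negP => Lb.
    have Tj : [exists b, (b != a) && (L b j != 0)].
      by apply/existsP; exists b; rewrite ba.
    have /negP[] := cP (exist _ j Tj); apply/eqP/matrixP => x y.
    rewrite !mxE -[RHS]lj lamE; apply: eq_bigr => b' _.
    by rewrite !mxE !ord1; case: eqP; rewrite ?mulr0.
  rewrite lamE big1 // => b _; case: ifP => // /negbT ba.
  by have := h b; rewrite ba => /eqP->; rewrite mulr0.
pose mu := row a L.
(* a step too small to change the sign of a nonzero coordinate of lam *)
pose e := \big[Num.min/1]_(j | lam 0 j != 0) (`|lam 0 j| / (1 + `|mu 0 j|)).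
have e0 : 0 < e.
  rewrite /e; elim/big_ind: _ => // [x y x0 y0|j lj].
    by rewrite lt_min x0.
  by rewrite divr_gt0 ?normr_gt0 // ltr_pwDl.
have eP j : lam 0 j != 0 -> e * `|mu 0 j| < `|lam 0 j|.
  move=> lj; have m1 : 0 < 1 + `|mu 0 j| by rewrite ltr_pwDl.
  have : e <= `|lam 0 j| / (1 + `|mu 0 j|) by rewrite /e; apply: bigmin_le_cond.
  rewrite ler_pdivlMr // => h; apply: lt_le_trans h.
  by rewrite ltr_pM2l // ltrDr.
pose nu : 'rV[R]_n := \row_j (if lam 0 j == 0 then `|mu 0 j| else 0).
have nuz : nu *m z = 0.
  have E : posmx (lam + e *: mu) + posmx (lam - e *: mu) - posmx lam
           - posmx lam = e *: nu.
    apply/rowP => j; rewrite !mxE.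
    have [lj|lj] := eqVneq (lam 0 j) 0.
      have := lj; rewrite !mxE => ->.
      rewrite !add0r maxxx !subr0.
      rewrite eqxx; have [La|La] := lerP 0 (L a j).
        have h : 0 <= e * L a j by rewrite mulr_ge0 // ltW.
        have h' : - (e * L a j) <= 0 by rewrite oppr_le0.
        by rewrite (max_r h) (max_l h') addr0 ger0_norm.
      have h : e * L a j <= 0 by rewrite pmulr_rle0 // ltW.
      have h' : 0 <= - (e * L a j) by rewrite oppr_ge0.
      by rewrite (max_l h) (max_r h') add0r ltr0_norm // mulrN.
    have := eP j lj; have := lj; rewrite !mxE.
    set s := \sum_j0 _; set t := L a j => s0.
    have -> : e * `|t| = `|e * t| by rewrite normrM gtr0_norm.
    rewrite (negPf s0) mulr0 ltr_norml; have [sp|] := boolP (0 < s).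
      rewrite (gtr0_norm sp) => /andP[h1 h2].
      rewrite !max_r; [ring|lra|lra|lra].
    rewrite -leNgt => sn; rewrite (ler0_norm sn) => /andP[h1 h2].
    rewrite !max_l; [ring|lra|lra|lra].
  have : e *: nu *m z = 0.
    rewrite -E !mulmxBl !mulmxDl.
    have -> : lam + e *: mu = (c' + e *: delta_mx 0 a) *m L.
      by rewrite mulmxDl -scalemxAl -rowE.
    have -> : lam - e *: mu = (c' - e *: delta_mx 0 a) *m L.
      by rewrite mulmxBl -scalemxAl -rowE.
    by rewrite !Lz addr0 !subr0.
  rewrite -scalemxAl => /eqP; rewrite scaler_eq0 (gt_eqF e0) /=.
  by move/eqP.
have nu0 : nu != 0.
  apply/rV0Pn; exists (f a); rewrite mxE lam0 ifT.
    by rewrite !mxE LfE eqxx normr1 oner_eq0.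
  by apply/forallP => b; apply/implyP => ba; rewrite LfE (negPf ba).
apply: leq_trans (zk nu nu0 nuz) _; apply: subset_leq_card.
apply/fintype.subsetP => j; rewrite !inE mxE -lam0.
by case: ifP; rewrite ?eqxx // normr_eq0 !mxE => _ ->.
Qed.

(** Cramer's rule for a system whose matrix is the identity. *)
Lemma det_col_replace (R : comPzRingType) (l : nat) (a : 'I_l) (v : 'cV[R]_l) :
  \det (\matrix_(i, j) (if j == a then v i 0 else (i == j)%:R)) = v a 0.
Proof.
set M := \matrix_(i, j) _.
rewrite (expand_det_col _ a).
have cE i : cofactor M i a = cofactor 1%:M i a.
  rewrite /cofactor; congr (_ * \det _); apply/matrixP => x y.
  by rewrite !mxE eq_sym (negPf (neq_lift _ _)).
have adj1 : \adj 1%:M = 1%:M :> 'M[R]_l by rewrite -[LHS]mul1mx mul_mx_adj det1.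
rewrite (bigD1 a) //= big1 => [|i ia].
  rewrite addr0 mxE eqxx cE; have /matrixP/(_ a a) := adj1.
  by rewrite mxE => ->; rewrite mxE eqxx mulr1.
rewrite cE; have /matrixP/(_ a i) := adj1.
by rewrite !mxE [a == i]eq_sym (negPf ia) => ->; rewrite mulr0.
Qed.

(** Normalising a maximal minor of any basis of the left kernel to the identity
    bounds all entries by 1: by Cramer's rule an entry is the quotient of another
    minor by the maximal one. Such bases live in a compact set, and their
    limits keep full rank. *)
Lemma kernel_basis_bounded (R : realFieldType) (l n d : nat) (Z : 'M[R]_(n, d)) :
  (l + \rank Z <= n)%N ->
  exists (L : 'M[R]_(l, n)) (f : {ffun 'I_l -> 'I_n}),
    [/\ L *m Z = 0, colsub f L = 1%:M & forall a j, `|L a j| <= 1].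
Proof.
move=> lr.
have [L0 [L0Z L0r]] : exists L0 : 'M[R]_(l, n), L0 *m Z = 0 /\ row_free L0.
  have rk : (l <= \rank (kermx Z))%N.
    by rewrite mxrank_ker leq_subRL ?rank_leq_row // addnC.
  exists (pid_mx l *m row_base (kermx Z)); split.
    apply/sub_kermxP; rewrite mulmx_sub //.
    by rewrite eq_row_base.
  rewrite /row_free mxrankMfree ?row_base_free //.
  by rewrite rank_pid_mx.
have [f0 f0P] : exists f0 : {ffun 'I_l -> 'I_n}, \det (colsub f0 L0) != 0.
  have L0f : row_full L0^T by rewrite /row_full mxrank_tr.
  exists (fullrankfun L0f).
  have := fullrowsub_unit L0f.
  by rewrite unitmxE unitfE -det_tr trmx_mxsub trmxK.
pose f := [arg max_(g > f0 | true) `|\det (colsub g L0)|]%O.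
have fP (g : {ffun 'I_l -> 'I_n}) : `|\det (colsub g L0)| <= `|\det (colsub f L0)|.
  by rewrite /f; case: arg_maxP => // h _; apply.
have fu : colsub f L0 \in unitmx.
  rewrite unitmxE unitfE -normr_gt0; apply: lt_le_trans (fP f0).
  by rewrite normr_gt0.
exists (invmx (colsub f L0) *m L0), f; split.
- by rewrite -mulmxA L0Z mulmx0.
- by rewrite -[RHS](mulVmx fu) mulmx_colsub.
move=> a j; set L := _ *m L0.
pose g := [ffun b => if b == a then j else f b].
have Lf b c : L b (f c) = (b == c)%:R.
  have /matrixP/(_ b c) : colsub f L = 1%:M.
    by rewrite -[RHS](mulVmx fu) mulmx_colsub.
  by rewrite !mxE.
have dg : \det (colsub g L) = L a j.
  have <- : col j L a 0 = L a j by rewrite mxE.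
  rewrite -[RHS]det_col_replace.
  congr (\det _); apply/matrixP => b c.
  rewrite mxE [RHS]mxE [col j L _ _]mxE ffunE.
  by case: eqP => // _; rewrite -Lf.
have L0E : L0 = colsub f L0 *m L.
  by rewrite [RHS]mulKVmx.
have := fP g; rewrite {1}L0E -mulmx_colsub det_mulmx normrM dg.
rewrite -[X in _ <= X]mulr1 ler_pM2l // normr_gt0.
by rewrite -unitfE -unitmxE.
Qed.

Local Open Scope classical_set_scope.
Local Open Scope card_scope.
Local Open Scope ring_scope.

(** A maximal linearly independent family chosen inside S. *)
Lemma set_row_basis (F : fieldType) (d : nat) (S : set 'rV[F]_d) :
  exists m (D : 'M[F]_(m, d)),
    [/\ row_free D, forall i, S (row i D) & forall s, S s -> (s <= D)%MS].
Proof.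
pose P m := `[< exists D : 'M[F]_(m, d), row_free D /\ forall i, S (row i D) >].
have P0 : exists m, P m.
  exists 0%N; apply/asboolP; exists 0; split; last by case.
  by rewrite /row_free mxrank0.
have Pd m : P m -> (m <= d)%N.
  by move=> /asboolP [D [/eqP r _]]; rewrite -r rank_leq_col.
have [m /asboolP [D [Df DS]] mmax] := ex_maxnP P0 Pd.
exists m, D; split=> // s Ss; apply/negPn/negP => sD.
have : P (m + 1)%N.
  apply/asboolP; exists (col_mx D s); split; last first.
    move=> i; case: (split_ordP i) => j ->; first by rewrite rowKu.
    by rewrite rowKd row_id.
  have lt : (D < col_mx D s)%MS.
    have [h1 h2] : (D <= col_mx D s)%MS /\ (s <= col_mx D s)%MS.
      by apply/andP; rewrite -col_mx_sub.
    by rewrite ltmxE h1; apply: contra sD; apply: submx_trans.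
  have := rank_ltmx lt; rewrite (eqP Df) => mr.
  by rewrite /row_free eqn_leq rank_leq_row /= {1}addn1.
by move/mmax; rewrite addn1 ltnn.
Qed.

(** * Convex sets *)

(** Convexity with a bare real parameter, without the subtype of [0, 1]. *)
Definition segment_closed (R : realType) (d : nat) (A : set 'rV[R]_d) :=
  forall x y (t : R), 0 <= t -> t <= 1 -> A x -> A y -> A (t *: x + (1 - t) *: y).

Lemma convex_segment_closed (R : realType) (d : nat) (A : set 'rV[R]_d) :
  convex_set (A : set (convex_lmodType 'rV[R]_d)) -> segment_closed A.
Proof.
move=> cA x y t t0 t1 Ax Ay.
by have := cA x y (Itv01 t0 t1); rewrite !inE /conv /=; apply.
Qed.

Lemma convex_comb (R : realType) (d : nat) (I : finType) (A : set 'rV[R]_d)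
    (c : I -> R) (x : I -> 'rV[R]_d) :
  segment_closed A -> (forall i, 0 <= c i) -> (forall i, c i != 0 -> A (x i)) ->
  \sum_i c i = 1 -> A (\sum_i c i *: x i).
Proof.
move=> cA c0 cx c1.
suff H (s : seq I) : let S := \sum_(i <- s) c i in S != 0 ->
    A (S^-1 *: \sum_(i <- s) c i *: x i).
  by have := H (index_enum I); rewrite /= c1 oner_eq0 invr1 scale1r; apply.
elim: s => [|i s IH] /=; first by rewrite big_nil eqxx.
rewrite !big_cons; set S := \sum_(_ <- s) _ in IH *.
have S0 : 0 <= S by apply: sumr_ge0.
have [ci|ci] := eqVneq (c i) 0; first by rewrite ci scale0r !add0r.
have Ai := cx i ci.
have [Se|Sn] := eqVneq S 0.
  have sz : \sum_(j <- s) c j *: x j = 0.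
    rewrite big_seq big1 // => j js.
    have : c j <= S by rewrite /S (big_rem j) //= lerDl sumr_ge0.
    by rewrite Se => h; rewrite (le_anti (_ : c j <= 0 <= c j)) ?scale0r // h c0.
  by rewrite sz Se !addr0 scalerA mulVf // scale1r.
move=> T0; have T1 : 0 < c i + S by rewrite lt_def T0 addr_ge0.
set v := \sum_(_ <- s) _ in IH *.
have -> : (c i + S)^-1 *: (c i *: x i + v) =
    (c i / (c i + S)) *: x i + (1 - c i / (c i + S)) *: (S^-1 *: v).
  rewrite scalerDr !scalerA mulrC; congr (_ + _ *: _).
  by field; rewrite Sn T0.
apply: cA => //; last exact: IH.
  by rewrite divr_ge0 // ltW.
by rewrite ler_pdivrMr // mul1r lerDl.
Qed.

Lemma convex_comb_rest (R : realType) (d n : nat) (A : set 'rV[R]_d)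
    (c : 'I_n -> R) (x : 'I_n -> 'rV[R]_d) (x0 : 'rV[R]_d) :
  segment_closed A -> (forall i, 0 <= c i) -> (forall i, c i != 0 -> A (x i)) ->
  \sum_i c i <= 1 -> A x0 ->
  A (\sum_i c i *: x i + (1 - \sum_i c i) *: x0).
Proof.
move=> cA c0 cx c1 Ax0.
pose c' (i : option 'I_n) := if i is Some i then c i else 1 - \sum_i c i.
pose x' (i : option 'I_n) := if i is Some i then x i else x0.
have sumE (V : nmodType) (F : option 'I_n -> V) :
    \sum_(i < n.+1) F (unlift ord0 i) = F None + \sum_i F (Some i).
  rewrite big_ord_recl unlift_none; congr (_ + _).
  by apply: eq_bigr => i _; rewrite liftK.
have -> : \sum_i c i *: x i + (1 - \sum_i c i) *: x0 =
    \sum_(i < n.+1) c' (unlift ord0 i) *: x' (unlift ord0 i).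
  by rewrite (sumE _ (fun i => c' i *: x' i)) addrC.
apply: (convex_comb cA).
- by move=> i; case: unliftP => [j _|_] //=; rewrite subr_ge0.
- by move=> i; case: unliftP => [j _|_] //=; exact: cx.
- by rewrite (sumE _ c') /= subrK.
Qed.

(** Radon's theorem in the form used for Helly's: an affine dependency between
    the u i splits them into two groups with a common convex combination, and
    every j is absent from one of the groups. *)
Lemma radon_point (R : realType) (n d : nat) (A : 'I_n -> set 'rV[R]_d)
    (u : 'I_n -> 'rV[R]_d) :
  (d.+2 <= n)%N -> (forall j, segment_closed (A j)) ->
  (forall i j, i != j -> A j (u i)) ->
  exists q, forall j, A j q.
Proof.
move=> nd cA uA.
pose B : 'M[R]_(n, 1 + d) := row_mx (const_mx 1) (\matrix_i u i).
have [lam l0 /eqP lB] : exists2 lam : 'rV_n, lam != 0 & lam *m B == 0.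
  have kn : kermx B != 0.
    rewrite -mxrank_eq0 mxrank_ker -lt0n subn_gt0.
    exact: leq_ltn_trans (rank_leq_col _) _.
  have /rowV0Pn [v vB v0] := kn.
  by exists v => //; apply/eqP/sub_kermxP.
move: lB; rewrite mul_mx_row -row_mx0 => /eq_row_mx [l1 lu].
have s0 : \sum_i lam 0 i = 0.
  have /matrixP/(_ 0 0) := l1; rewrite !mxE => e; rewrite -[RHS]e.
  by apply: eq_bigr => i _; rewrite mxE mulr1.
have su : \sum_i lam 0 i *: u i = 0.
  rewrite -[RHS]lu mulmx_sum_row; apply: eq_bigr => i _.
  by rewrite rowK.
pose p i := posmx lam 0 i.
pose m i := posmx (- lam) 0 i.
have pm i : lam 0 i = p i - m i by rewrite /p /m -{1}(posmxB lam) !mxE.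
have p0 i : 0 <= p i by exact: posmx_ge0.
have m0 i : 0 <= m i by exact: posmx_ge0.
have sE : \sum_i p i = \sum_i m i.
  apply/eqP; rewrite -subr_eq0 -sumrB; apply/eqP.
  by rewrite -[RHS]s0; apply: eq_bigr => i _.
have uE : \sum_i p i *: u i = \sum_i m i *: u i.
  apply/eqP; rewrite -subr_eq0 -sumrB; apply/eqP.
  by rewrite -[RHS]su; apply: eq_bigr => i _; rewrite pm scalerBl.
set S := \sum_i p i in sE.
have S0 : S != 0.
  apply: contra l0 => /eqP Sz; apply/eqP/rowP => i; rewrite mxE pm.
  have pz : p i = 0 by apply: (psumr_eq0P _ Sz) => // *; exact: p0.
  rewrite sE in Sz.
  have mz : m i = 0 by apply: (psumr_eq0P _ Sz) => // *; exact: m0.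
  by rewrite pz mz subr0.
exists (\sum_i (S^-1 * p i) *: u i) => j.
(* use whichever of the two expressions of the Radon point avoids u j *)
have Sp : 0 <= S^-1 by rewrite invr_ge0 sumr_ge0.
have [lj|lj] := lerP (lam 0 j) 0.
  apply: (convex_comb (cA j)) => [i|i|]; first exact: mulr_ge0.
    move=> pi; apply: uA; apply: contra_neq pi => ->.
    by rewrite /p mxE max_l ?mulr0.
  by rewrite -mulr_sumr mulVf.
have -> : \sum_i (S^-1 * p i) *: u i = \sum_i (S^-1 * m i) *: u i.
  by under eq_bigr do rewrite -scalerA; under [RHS]eq_bigr do rewrite -scalerA;
     rewrite -!scaler_sumr uE.
apply: (convex_comb (cA j)) => [i|i|]; first exact: mulr_ge0.
  move=> pi; apply: uA; apply: contra_neq pi => ->.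
  by rewrite /m !mxE max_l ?mulr0 // oppr_le0 ltW.
by rewrite -mulr_sumr -sE mulVf.
Qed.

(** The barycenter of affinely independent points spanning the affine hull of Q
    is an interior point of Q relative to that hull. *)
Lemma relative_interior_point (R : realType) (d : nat) (Q : set 'rV[R]_d) :
  segment_closed Q -> Q !=set0 ->
  exists q m (D : 'M[R]_(m, d)) (e : R),
    [/\ 0 < e, forall x, Q x -> (x - q <= D)%MS &
        forall a : 'rV_m, (forall i, `|a 0 i| <= e) -> Q (q + a *m D)].
Proof.
move=> cQ [q0 Qq0].
have [m [D [_ DQ Dm]]] := set_row_basis [set x - q0 | x in Q].
pose N : R := m.+1%:R.
have N0 : 0 < N by rewrite ltr0n.
pose g := \sum_i N^-1 *: row i D.
have gD : (g <= D)%MS by apply: summx_sub => i _; rewrite scalemx_sub ?row_sub.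
exists (q0 + g), m, D, (N^-1 / N); split.
- by rewrite divr_gt0 ?invr_gt0.
- move=> x Qx; rewrite opprD addrA addmx_sub ?eqmx_opp //.
  by apply: Dm; exists x.
move=> a ae.
have ab i : - (N^-1 / N) <= a 0 i /\ a 0 i <= N^-1 / N.
  by have := ae i; rewrite ler_norml => /andP.
have NN : N^-1 / N <= N^-1.
  have N1 : 1 <= N by rewrite ler1n.
  by rewrite ler_pdivrMr // ler_peMr // invr_ge0 ltW.
have -> : q0 + g + a *m D = \sum_i (N^-1 + a 0 i) *: (q0 + row i D) +
    (1 - \sum_i (N^-1 + a 0 i)) *: q0.
  under [X in _ = X + _]eq_bigr => i _ do
    rewrite scalerDr (scalerDl (row i D)).
  rewrite mulmx_sum_row [X in _ = X + _]big_split /= -scaler_suml.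
  rewrite [RHS]addrAC.
  by rewrite -scalerDl [_ + (1 - _)]addrC subrK scale1r [in RHS]big_split /= addrA.
apply: (convex_comb_rest cQ) => [i|i _||//].
- have [h _] := ab i; apply: (@le_trans _ _ (N^-1 - N^-1 / N)).
    by rewrite subr_ge0.
  by rewrite lerD2l.
- by have [y Qy <-] := DQ i; rewrite addrC subrK.
apply: (@le_trans _ _ (\sum_(j < m) (N^-1 + N^-1 / N))).
  by apply: ler_sum => j _; have [_ h] := ab j; rewrite lerD2l.
rewrite sumr_const card_ord -mulr_natl.
have -> : m%:R = N - 1 by rewrite /N -natr1 addrK.
have -> : (N - 1) * (N^-1 + N^-1 / N) = 1 - (N^-1)^+2.
  by field; rewrite gt_eqF.
by rewrite lerBlDr lerDl sqr_ge0.
Qed.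

(** The recession directions at q form a convex cone. *)
Lemma recession_cone_comb (R : realType) (d m : nat) (Q : set 'rV[R]_d)
    (q : 'rV[R]_d) (N : 'M[R]_(m, d)) :
  segment_closed Q -> Q q ->
  (forall i (t : R), 0 <= t -> Q (q + t *: row i N)) ->
  forall a : 'rV[R]_m, (forall i, 0 <= a 0 i) -> Q (q + a *m N).
Proof.
move=> cQ Qq QN a a0.
rewrite mulmx_sum_row.
pose M : R := m.+1%:R.
have M0 : 0 < M by rewrite ltr0n.
have e : \sum_(i < m) M^-1 <= 1.
  by rewrite sumr_const card_ord -[X in X <= _]mulr_natl ler_pdivrMr // mul1r ler_nat.
have := @convex_comb_rest R d m Q (fun=> M^-1) (fun i => q + (M * a 0 i) *: row i N) q.
have -> : \sum_i M^-1 *: (q + (M * a 0 i) *: row i N) +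
   (1 - \sum_(i < m) M^-1) *: q = q + \sum_i a 0 i *: row i N.
  under eq_bigr => i _ do rewrite scalerDr scalerA mulKf ?gt_eqF //.
  rewrite big_split /= -scaler_suml addrAC -scalerDl.
  by rewrite [_ + (1 - _)]addrC subrK scale1r.
apply=> // i; first by rewrite invr_ge0 ltW.
by move=> _; apply: QN; rewrite mulr_ge0 // ltW.
Qed.

(** * Limits along an ultrafilter *)

(** Entrywise convergence, so that only limits of real sequences are needed. *)
Definition entries_cvg (R : realType) (U : set_system nat) (p q : nat)
    (A : nat -> 'M[R]_(p, q)) (B : 'M[R]_(p, q)) :=
  forall i j, (fun m => A m i j) @ U --> B i j.

Lemma entries_cvg_cst (R : realType) (U : set_system nat) {FU : ProperFilter U}
    (p q : nat) (A : 'M[R]_(p, q)) : entries_cvg U (fun=> A) A.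
Proof. by move=> i j; apply: cvg_cst. Qed.

Lemma entries_cvgD (R : realType) (U : set_system nat) {FU : ProperFilter U}
    (p q : nat) A B (A' B' : 'M[R]_(p, q)) :
  entries_cvg U A A' -> entries_cvg U B B' ->
  entries_cvg U (fun m => A m + B m) (A' + B').
Proof.
move=> cA cB i j; rewrite mxE; under eq_fun do rewrite mxE.
exact: (cvgD (cA i j) (cB i j)).
Qed.

Lemma entries_cvgN (R : realType) (U : set_system nat) {FU : ProperFilter U}
    (p q : nat) A (A' : 'M[R]_(p, q)) :
  entries_cvg U A A' -> entries_cvg U (fun m => - A m) (- A').
Proof.
move=> cA i j; rewrite mxE; under eq_fun do rewrite mxE.
exact: (cvgN (cA i j)).
Qed.

Lemma entries_cvgM (R : realType) (U : set_system nat) {FU : ProperFilter U}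
    (p q r : nat) A B (A' : 'M[R]_(p, q)) (B' : 'M[R]_(q, r)) :
  entries_cvg U A A' -> entries_cvg U B B' ->
  entries_cvg U (fun m => A m *m B m) (A' *m B').
Proof.
move=> cA cB i j; rewrite mxE; under eq_fun do rewrite mxE.
apply: cvg_big => [|s _]; first exact: add_continuous.
by apply: cvgM; [exact: cA|exact: cB].
Qed.

Lemma entries_cvg_posmx (R : realType) (U : set_system nat) {FU : ProperFilter U}
    (p q : nat) A (A' : 'M[R]_(p, q)) :
  entries_cvg U A A' -> entries_cvg U (fun m => posmx (A m)) (posmx A').
Proof.
move=> cA i j.
have maxE (x : R) : Num.max 0 x = (x + `|x|) / 2.
  by case: (lerP 0 x) => h; [rewrite ger0_norm //|rewrite ltr0_norm //]; field.
rewrite mxE maxE; under eq_fun do rewrite mxE maxE.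
apply: cvgM; last exact: cvg_cst.
by apply: cvgD; [exact: cA|apply: cvg_norm; exact: cA].
Qed.

Lemma entries_cvg_unique (R : realType) (U : set_system nat) {FU : ProperFilter U}
    (p q : nat) A (A' A'' : 'M[R]_(p, q)) :
  entries_cvg U A A' -> entries_cvg U A A'' -> A' = A''.
Proof.
move=> c1 c2; apply/matrixP => i j.
exact: (@cvg_unique R^o _ _ _ _ _ (c1 i j) (c2 i j)).
Qed.

Lemma ultrafilter_infty : exists U : set_system nat, UltraFilter U /\ \oo `<=` U.
Proof. by have [U [? ?]] := @ultraFilterLemma nat \oo _; exists U. Qed.

Lemma ultra_bounded_cvg (R : realType) (U : set_system nat) {UU : UltraFilter U}
    (x : nat -> R) : (forall m, `|x m| <= 1) -> exists a : R, x @ U --> a.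
Proof.
move=> xb; have /(_ (x @ U)) [|a [_ xa]] := @segment_compact R (-1) 1.
  by apply: (@filterE _ U) => m; rewrite /= in_itv /= -ler_norml.
exists a => B aB; have [//|nB] := in_ultra_setVsetC (x @^-1` B) UU.
by have [y []] := xa (~` B) B nB aB.
Qed.

Lemma ultra_finite_cst (T : finType) (U : set_system nat) {UU : UltraFilter U}
    (g : nat -> T) : exists t, U [set m | g m = t].
Proof.
apply: contrapT => /forallNP h.
have : U (fun m => forall t, g m <> t).
  apply: filter_forall => t.
  by have [/h|] := in_ultra_setVsetC [set m | g m = t] UU.
by move=> /filter_ex [m /(_ (g m))].
Qed.

(** Compactness of the Grassmannian, in coordinates: along an ultrafilter,
    l-dimensional subspaces of the left kernels of the Z m have a limit, again
    of dimension l. *)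
Lemma kernel_limit (R : realType) (n d l : nat) (Z : nat -> 'M[R]_(n, d)) :
  (forall m, l + \rank (Z m) <= n)%N ->
  exists (U : set_system nat) (L : nat -> 'M[R]_(l, n)) (Lb : 'M[R]_(l, n))
         (f : 'I_l -> 'I_n),
    [/\ ProperFilter U /\ \oo `<=` U,
        forall m, L m *m Z m = 0,
        forall m i j, `|L m i j| <= 1,
        entries_cvg U L Lb &
        colsub f Lb = 1%:M].
Proof.
move=> lZ.
have /choice [Lf LfP] : forall m, exists Lf : 'M[R]_(l, n) * {ffun 'I_l -> 'I_n},
    [/\ Lf.1 *m Z m = 0, colsub Lf.2 Lf.1 = 1%:M &
        forall a j, `|Lf.1 a j| <= 1].
  by move=> m; have [L [f LP]] := kernel_basis_bounded (lZ m); exists (L, f).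
have [U [UU oU]] := ultrafilter_infty.
have [f fU] := ultra_finite_cst (fun m => (Lf m).2).
have /choice [Lb0 Lb0P] : forall ij : 'I_l * 'I_n, exists a : R,
    (fun m => (Lf m).1 ij.1 ij.2) @ U --> a.
  by move=> ij; apply: ultra_bounded_cvg => m; have [_ _] := LfP m; apply.
pose Lb : 'M[R]_(l, n) := \matrix_(i, j) Lb0 (i, j).
have LU : entries_cvg U (fun m => (Lf m).1) Lb.
  by move=> i j; rewrite mxE; exact: (Lb0P (i, j)).
exists U, (fun m => (Lf m).1), Lb, f; split=> //.
- by split=> //; exact: ultra_proper.
- by move=> m; have [] := LfP m.
- by move=> m; have [] := LfP m.
apply: (@entries_cvg_unique R U _ l l (fun m => colsub f (Lf m).1)) => i j.
  by rewrite mxE; under eq_fun do rewrite mxE; exact: LU.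
apply: cvg_near_cst; apply: filterS fU => m /= <-.
by have [_ -> _] := LfP m.
Qed.

(** Limits of directions of points of Q going to infinity are recession directions
    of Q itself, not only of its closure, at a relative interior point q: the
    error between w m and its limit is absorbed by the ball around q. *)
Lemma recession_limit (R : realType) (U : set_system nat) {FU : ProperFilter U}
    (d r : nat) (Q : set 'rV[R]_d) (q : 'rV[R]_d) (D : 'M[R]_(r, d)) (e s : R)
    (w : nat -> 'rV[R]_d) (wb : 'rV[R]_d) :
  \oo `<=` U -> segment_closed Q -> 0 < e -> (forall x, Q x -> (x - q <= D)%MS) ->
  (forall a : 'rV_r, (forall i, `|a 0 i| <= e) -> Q (q + a *m D)) ->
  entries_cvg U w wb -> 0 < s -> (forall m, Q (q + (m.+1%:R / s) *: w m)) ->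
  forall t, 0 <= t -> Q (q + t *: wb).
Proof.
move=> oU cQ e0 QD QB wc s0 wQ t t0.
have qQ : Q q.
  have := QB 0; rewrite mul0mx addr0; apply => i.
  by rewrite mxE normr0 ltW.
have ms0 m : 0 < m.+1%:R / s by rewrite divr_gt0 ?ltr0n.
have wD m : (w m <= D)%MS.
  have := QD _ (wQ m); by rewrite addrAC subrr add0r eqmx_scale // gt_eqF ?ms0.
have wbD : (wb <= D)%MS.
  rewrite submxE; apply/eqP.
  have h : entries_cvg U (fun m => w m *m cokermx D) (wb *m cokermx D).
    by apply: entries_cvgM => //; exact: entries_cvg_cst.
  apply: (entries_cvg_unique h) => i j.
  have -> : (fun m => (w m *m cokermx D) i j) = fun=> (0 : 'M[R]_(1, d)) i j.
    by apply/funext => m; have := wD m; rewrite submxE => /eqP->.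
  exact: cvg_cst.
pose a m := (2 * t) *: ((wb - w m) *m pinvmx D).
have ac : entries_cvg U a 0.
  have h : entries_cvg U (fun m => (wb - w m) *m ((2 * t) *: pinvmx D))
      ((wb - wb) *m ((2 * t) *: pinvmx D)).
    apply: entries_cvgM; last exact: entries_cvg_cst.
    apply: entries_cvgD; first exact: entries_cvg_cst.
    exact: entries_cvgN.
  rewrite subrr mul0mx in h.
  by move=> i j; have := h i j; under eq_fun do rewrite -scalemxAr.
have : U (fun m => forall i, `|a m 0 i| <= e).
  apply: filter_forall => i.
  have := ac 0 i; rewrite mxE => /cvgr0_norm_le/(_ e e0); exact.
have : U (fun m => 2 * t * s < m%:R).
  by apply: oU; apply: nbhs_infty_gtr.
move=> U1 U2; have [m [m1 m2]] := filter_ex (filterI U1 U2).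
have Qa : Q (q + a m *m D) by apply: QB.
have tm : 2 * t / (m.+1%:R / s) <= 1.
  rewrite ler_pdivrMr ?divr_gt0 ?ltr0n // mul1r ler_pdivlMr //.
  by apply: ltW; apply: lt_trans m1 _; rewrite ltr_nat.
have Qw : Q (q + (2 * t) *: w m).
  pose c := 2 * t / (m.+1%:R / s).
  have -> : q + (2 * t) *: w m = c *: (q + (m.+1%:R / s) *: w m) + (1 - c) *: q.
    have -> : 2 * t = c * (m.+1%:R / s) by rewrite divfK // gt_eqF.
    by apply/rowP => i; rewrite !mxE; ring.
  apply: cQ => //; apply: divr_ge0; last exact: ltW.
  exact: mulr_ge0.
have -> : q + t *: wb =
    2^-1 *: (q + a m *m D) + (1 - 2^-1) *: (q + (2 * t) *: w m).
  have -> : a m *m D = (2 * t) *: (wb - w m).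
    by rewrite /a -scalemxAl mulmxKpV // addmx_sub // eqmx_opp.
  by apply/rowP => i; rewrite !mxE; field.
by apply: cQ => //; lra.
Qed.

(** * Cones *)

Lemma row_vspace (F : fieldType) (m d : nat) (D : 'M[F]_(m, d)) :
  row_free D ->
  exists L : {vspace 'rV[F]_d}, (forall x, (x \in L) = (x <= D)%MS) /\ \dim L = m.
Proof.
move=> Df; pose b := [tuple row i D | i < m].
have bE (i : 'I_m) : b`_i = row i D by rewrite -tnth_nth tnth_mktuple.
exists <<b>>%VS; split.
  move=> x; apply/idP/idP => [/coord_span ->|/submxP [a ->]].
    by apply: summx_sub => i _; rewrite bE scalemx_sub // row_sub.
  rewrite mulmx_sum_row; apply: memv_suml => i _; apply: memvZ.
  by apply: memv_span; rewrite -bE mem_nth // size_tuple.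
have /eqP -> : free b; last by rewrite size_tuple.
apply/freeP => c; under eq_bigr do rewrite bE.
move=> c0 i; have : (\row_i c i) *m D = 0.
  by rewrite mulmx_sum_row -[RHS]c0; apply: eq_bigr => j _; rewrite mxE.
by move/eqP; rewrite mulmx_free_eq0 // => /eqP /rowP /(_ i); rewrite !mxE.
Qed.

Lemma cone_comb (R : realType) (d m : nat) (u : 'rV[R]_d) (V : set 'rV[R]_d)
    (D : 'M[R]_(m, d)) (c : 'rV[R]_m) :
  (forall i, V (row i D)) -> (forall i, 0 <= c 0 i) -> cone u V (u + c *m D).
Proof.
move=> VD c0.
exists [fset row i D | i in 'I_m]%fset, (fun v => \sum_(i | row i D == v) c 0 i).
split.
- by move=> v /= /imfsetP [i _ ->].
- by move=> v _; apply: sumr_ge0.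
congr (_ + _); rewrite mulmx_sum_row.
under [RHS]eq_bigr do rewrite scaler_suml big_mkcond.
rewrite exchange_big /=; apply: eq_bigr => i _.
have iW : row i D \in [fset row i D | i in 'I_m]%fset.
  by apply/imfsetP; exists i.
rewrite (bigD1_seq _ iW (fset_uniq _)) /=.
rewrite eqxx big1 ?addr0 //.
by move=> v; rewrite eq_sym => /negPf ->.
Qed.

Lemma affine_hull2 (R : realType) (d : nat) (A : set 'rV[R]_d) x y t :
  A x -> A y -> affine_hull A (t *: x + (1 - t) *: y).
Proof.
move=> Ax Ay; have [->|xy] := eqVneq x y.
  exists [fset y]%fset, (fun=> 1); split.
  - by move=> v /=; rewrite inE => /eqP ->.
  - by rewrite big_seq_fset1.
  - by rewrite big_seq_fset1 -scalerDl addrC subrK.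
exists [fset x; y]%fset, (fun v => if v == x then t else 1 - t); split.
- by move=> v /=; rewrite !inE => /orP[] /eqP ->.
- rewrite big_fsetU1 ?inE //= big_seq_fset1 eqxx eq_sym (negPf xy).
  by rewrite addrC subrK.
- by rewrite big_fsetU1 ?inE //= big_seq_fset1 eqxx [y == x]eq_sym (negPf xy).
Qed.

(** Every vector of the span of the generators is a difference of two elements of
    the cone, so the affine hull of the cone is a translate of that span. *)
Lemma affine_hull_cone (R : realType) (d m : nat) (u : 'rV[R]_d)
    (V : set 'rV[R]_d) (D : 'M[R]_(m, d)) (L : {vspace 'rV[R]_d}) :
  (forall i, V (row i D)) -> (forall v, V v -> (v <= D)%MS) ->
  (forall x, (x \in L) = (x <= D)%MS) ->
  affine_hull (cone u V) = [set u + v | v in [set` L]].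
Proof.
move=> VD DV LD; apply/seteqP; split=> x.
  move=> [W [t [WV t1 ->]]].
  exists (\sum_(v <- W) t v *: (v - u)); last first.
    under eq_bigr do rewrite scalerBr.
    by rewrite sumrB -scaler_suml t1 scale1r addrC subrK.
  rewrite /= LD big_seq; apply: summx_sub => v vW; apply: scalemx_sub.
  have [W' [al [W'V _ ->]]] := WV v vW.
  rewrite addrAC subrr add0r big_seq; apply: summx_sub => v' v'W.
  by apply: scalemx_sub; apply: DV; apply: W'V.
move=> [y]; rewrite /= LD => /submxP [a ->] <-.
set p := posmx a; set q := posmx (- a).
have pq : a = p - q by rewrite posmxB.
have p0 i : 0 <= p 0 i by exact: posmx_ge0.
have q0 i : 0 <= q 0 i by exact: posmx_ge0.
(* the line through the two cone points u + p D and u + (p + q) D *)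
have -> : u + a *m D = 2 *: (u + p *m D) + (1 - 2) *: (u + (p + q) *m D).
  rewrite pq mulmxBl mulmxDl; apply/rowP => i.
  by rewrite !mxE; ring.
apply: affine_hull2; apply: cone_comb => // i.
by rewrite mxE addr_ge0.
Qed.

(** Only simplicial cones matter: a k-dimensional cone contains the one spanned
    by k linearly independent generators. *)
Lemma contains_coneP (R : realType) (d k : nat) (S : set 'rV[R]_d) :
  contains_cone k S <->
  exists (u : 'rV[R]_d) (W : 'M[R]_(k, d)), row_free W /\
    forall c : 'rV[R]_k, (forall i, 0 <= c 0 i) -> S (u + c *m W).
Proof.
split=> [[u [V [[p [L [hL dL]]] VS]]]|[u [W [Wf WS]]]].
  have [m [D [Df VD DV]]] := set_row_basis V.
  have [L' [L'D dL']] := row_vspace Df.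
  have e := affine_hull_cone u VD DV L'D.
  have mk : m = k.
    rewrite -dL' -dL; congr (\dim _); apply/vspaceP => x.
    have uL : [set p + v | v in [set` L]] u.
      by rewrite -hL e; exists 0; rewrite /= ?mem0v ?addr0.
    have pL' : [set u + v | v in [set` L']] p.
      by rewrite -e hL; exists 0; rewrite /= ?mem0v ?addr0.
    apply/idP/idP => xL.
      have [y yL ye] : [set p + v | v in [set` L]] (u + x) by rewrite -hL e; exists x.
      have [z zL ze] := uL.
      have -> : x = y - z.
        rewrite -ze in ye; have -> : x = (p + z + x) - (p + z) by rewrite addrC addKr.
        by rewrite -ye opprD addrACA subrr add0r.
      exact: memvB.
    have [y yL ye] : [set u + v | v in [set` L']] (p + x) by rewrite -e hL; exists x.
    have [z zL ze] := pL'.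
    have -> : x = y - z.
      rewrite -ze in ye; have -> : x = (u + z + x) - (u + z) by rewrite addrC addKr.
      by rewrite -ye opprD addrACA subrr add0r.
    exact: memvB.
  clear L' L'D dL' e; subst m; exists u, D; split=> // c c0.
  by apply: VS; apply: cone_comb.
pose V := [set row i W | i in setT].
have VD i : V (row i W) by exists i.
have DV v : V v -> (v <= W)%MS by move=> [i _ <-]; apply: row_sub.
have [L [LW dL]] := row_vspace Wf.
exists u, V; split.
  by exists u, L; split=> //; apply: affine_hull_cone DV LW.
move=> x [X [al [XV al0 ->]]].
have [c [c0 ->]] : exists c : 'rV[R]_k, (forall i, 0 <= c 0 i) /\
    \sum_(v <- X) al v *: v = c *m W.
  rewrite big_seq; elim/big_rec: _ => [|v y vX [c [c0 ->]]].
    by exists 0; split=> [i|]; [rewrite mxE|rewrite mul0mx].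
  have [i _ iv] := XV v vX; exists (al v *: delta_mx 0 i + c); split.
    move=> j; rewrite !mxE addr_ge0 // mulr_ge0 ?ler0n //.
    exact: al0.
  by rewrite mulmxDl -scalemxAl -rowE iv.
exact: WS.
Qed.

Lemma contains_cone_leq (R : realType) (d k k0 : nat) (S : set 'rV[R]_d) q
    (N : 'M[R]_(k0, d)) :
  (k <= k0)%N -> row_free N ->
  (forall a : 'rV[R]_k0, (forall i, 0 <= a 0 i) -> S (q + a *m N)) ->
  contains_cone k S.
Proof.
move=> kk Nf NS; apply/contains_coneP; exists q, (pid_mx k *m N); split.
  by rewrite /row_free mxrankMfree // rank_pid_mx.
move=> c c0; rewrite mulmxA; apply: NS => i; rewrite mxE.
by apply: sumr_ge0 => j _; rewrite mulr_ge0 // mxE ler0n.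
Qed.

(** * The Helly-type theorem *)

Lemma mxrank_mulmx_cokermx (F : fieldType) (k k0 d : nat) (W : 'M[F]_(k, d))
    (N : 'M[F]_(k0, d)) :
  (\rank W - k0 <= \rank (W *m cokermx N))%N.
Proof.
rewrite leq_subLR addnC -(mxrank_mul_ker W (cokermx N)) leq_add2l.
apply: leq_trans (rank_leq_row N); apply: mxrankS.
by rewrite submxE; apply/eqP/sub_kermxP/capmxSr.
Qed.

(** One side of a Radon partition. The point
    q + (M / s)(p h + b N) is a convex combination of the points u i + M c i W i
    with weights p_i / s, and of a point of the cone q + pos N. Since p_j = 0, the
    only index for which the cone at u i may leave A is not involved. *)
Lemma positive_side_in_member (R : realType) (n d k k0 : nat) (A : set 'rV[R]_d)
    (j : 'I_n) (u : 'I_n -> 'rV[R]_d) (W : 'I_n -> 'M[R]_(k, d)) (c : 'I_n -> 'rV[R]_k)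
    (q : 'rV[R]_d) (N : 'M[R]_(k0, d)) (h : 'M[R]_(n, d)) (M s : R)
    (p : 'rV[R]_n) (b : 'rV[R]_k0) :
  segment_closed A ->
  (forall i (c : 'rV_k), i != j -> (forall t, 0 <= c 0 t) -> A (u i + c *m W i)) ->
  (forall i t, 0 < c i 0 t) ->
  (forall a : 'rV[R]_k0, (forall i, 0 <= a 0 i) -> A (q + a *m N)) ->
  0 < M -> (forall i, row i h = M^-1 *: (u i - q) + c i *m W i) ->
  (forall i, 0 <= p 0 i) -> p 0 j = 0 -> \sum_i p 0 i < s ->
  (forall i, 0 <= b 0 i) ->
  A (q + (M / s) *: (p *m h + b *m N)).
Proof.
move=> cA WA c0 NA M0 hE p0 pj ps b0.
set S := \sum_i p 0 i in ps.
have S0 : 0 <= S by apply: sumr_ge0.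
have s0 : 0 < s by apply: le_lt_trans ps.
have sS : 0 < s - S by rewrite subr_gt0.
have sumE : \sum_i p 0 i / s = S / s by rewrite -mulr_suml.
have := @convex_comb_rest R d n A (fun i => p 0 i / s)
   (fun i => u i + (M *: c i) *m W i) (q + ((M / (s - S)) *: b) *m N).
have -> : \sum_i (p 0 i / s) *: (u i + (M *: c i) *m W i) +
    (1 - \sum_i p 0 i / s) *: (q + ((M / (s - S)) *: b) *m N) =
    q + (M / s) *: (p *m h + b *m N).
  have E i : u i + (M *: c i) *m W i = q + M *: row i h.
    rewrite hE scalerDr scalerA divff ?gt_eqF // scale1r -scalemxAl.
    by rewrite addrA [q + _]addrC subrK.
  under eq_bigr => i _ do rewrite E scalerDr.
  have hS : \sum_i (p 0 i / s) *: (M *: row i h) = (M / s) *: (p *m h).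
    rewrite mulmx_sum_row scaler_sumr; apply: eq_bigr => i _.
    by rewrite !scalerA; congr (_ *: _); ring.
  rewrite big_split /= -scaler_suml sumE hS -scalemxAl.
  set v := p *m h; set w := b *m N.
  apply/rowP => i; rewrite !mxE; field.
  by rewrite !gt_eqF.
apply=> //.
- by move=> i; rewrite divr_ge0 // ltW.
- move=> i pi; apply: WA.
    by apply: contra_neq pi => ->; rewrite pj mul0r.
  by move=> t; rewrite mxE mulr_ge0 // ltW.
- by rewrite sumE ler_pdivrMr // mul1r ltW.
- by apply: NA => i; rewrite mxE mulr_ge0 // divr_ge0 // ltW.
Qed.

(** The inductive step. Let q be a relative interior point of the intersection
    Q, and let N span the recession cone of Q at q; suppose that it has k0 < k
    rows. With v_i = c_i W_i in general position, consider the points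
    u_i + (m + 1) v_i for growing m and the linear dependencies, modulo the span
    of N, between the vectors from q to these points. Up to recession directions
    both sides of such a dependency are the same vector, and a multiple of it
    leads from q to a point of Q. As m grows, the positive side of every limiting
    dependency comes to lie in the span of N, and blocks_card bounds the number
    l = n - (d - k0) of independent limiting dependencies by
    l (k - k0 + 1) <= n. With l >= 2 and n > 2 (d - k + 1) this is impossible. *)
Lemma critical_family (R : realType) (n d k : nat) (A : 'I_n -> set 'rV[R]_d) :
  (0 < k <= d)%N -> (d.+2 <= n)%N -> (2 * (d - k + 1) < n)%N ->
  (forall j, segment_closed (A j)) ->
  (forall i, contains_cone k [set x | forall j, i != j -> A j x]) ->
  contains_cone k [set x | forall j, A j x].
Proof.
move=> kd nd nk cA hA.
have /choice [uW uWP] : forall i, exists uW : 'rV[R]_d * 'M[R]_(k, d),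
    row_free uW.2 /\ forall j (c : 'rV_k), i != j -> (forall t, 0 <= c 0 t) ->
      A j (uW.1 + c *m uW.2).
  move=> i; have /contains_coneP [u [W [Wf WA]]] := hA i.
  by exists (u, W); split=> // j c ij c0; apply: WA.
pose u i := (uW i).1; pose W i := (uW i).2.
have Wf i : row_free (W i) by case: (uWP i).
have WA i j (c : 'rV_k) : i != j -> (forall t, 0 <= c 0 t) -> A j (u i + c *m W i).
  by case: (uWP i) => _ h; apply: h.
set Q := [set x | _].
have cQ : segment_closed Q by move=> x y t t0 t1 Qx Qy j; apply: cA.
have uA i j : i != j -> A j (u i).
  move=> ij; have := WA i j 0 ij; rewrite mul0mx addr0; apply=> t.
  by rewrite mxE.
have [q [r [D [e [e0 QD QB]]]]] : exists q r (D : 'M[R]_(r, d)) (e : R),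
    [/\ 0 < e, forall x, Q x -> (x - q <= D)%MS &
        forall a : 'rV_r, (forall i, `|a 0 i| <= e) -> Q (q + a *m D)].
  by apply: relative_interior_point cQ _; exact: radon_point uA.
have Qq : Q q.
  have := QB 0; rewrite mul0mx addr0; apply => i.
  by rewrite mxE normr0 ltW.
have [k0 [N [Nf NK NM]]] :=
  set_row_basis [set w | forall t : R, 0 <= t -> Q (q + t *: w)].
have NQ := recession_cone_comb cQ Qq NK.
have [kk0|k0k] := leqP k k0; first exact: contains_cone_leq kk0 Nf NQ.
exfalso.
pose K := cokermx N.
have [c [c0 cP]] : exists c : 'I_n -> 'rV[R]_k, (forall i j, 0 < c i 0 j) /\
    forall lam : 'rV[R]_n, lam != 0 ->
      \sum_i lam 0 i *: (c i *m (W i *m K)) = 0 ->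
      (k - k0 < #|[set i | lam 0%R i != 0%R]%SET|)%N.
  apply: (kwise_independent (G := fun i => W i *m K)) => i.
  by have := mxrank_mulmx_cokermx (W i) N; rewrite (eqP (Wf i)).
pose V : 'M[R]_(n, d) := \matrix_i (c i *m W i).
pose Y : 'M[R]_(n, d) := \matrix_i (u i - q).
pose h (m : nat) : 'M[R]_(n, d) := (m.+1%:R)^-1 *: Y + V.
have hE m i : row i (h m) = (m.+1%:R)^-1 *: (u i - q) + c i *m W i.
  by rewrite linearD linearZ /= !rowK.
pose l := (n - (d - k0))%N.
have lK m : (l + \rank (h m *m K) <= n)%N.
  have : (\rank (h m *m K) <= d - k0)%N.
    apply: leq_trans (mxrankM_maxr _ _) _.
    by rewrite mxrank_coker (eqP Nf).
  rewrite /l; lia.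
have [U [L [Lb [f [[FU oU] LK L1 LU Lbf]]]]] := kernel_limit lK.
have hU : entries_cvg U h V.
  rewrite -[V]add0r; apply: entries_cvgD; last exact: entries_cvg_cst.
  move=> i j; rewrite mxE -(mul0r (Y i j)).
  under eq_fun do rewrite mxE.
  apply: cvgM; last exact: cvg_cst.
  exact: cvg_trans (cvg_app _ oU) cvg_harmonic.
have blocks : (l * (k - k0).+1 <= n)%N.
  apply: (@blocks_card R l n d (k - k0) Lb f (V *m K)) => // [a|lam l0 lV];
    last first.
    apply: cP => //; rewrite -[RHS]lV mulmx_sum_row.
    by apply: eq_bigr => i _; rewrite row_mul rowK mulmxA.
  pose lam m := a *m L m.
  pose b m := lam m *m h m *m pinvmx N.
  have bN m : b m *m N = lam m *m h m.
    rewrite mulmxKpV // submxE; apply/eqP.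
    by rewrite /lam -!mulmxA LK mulmx0.
  (* the two sides of the dependency lam m, made equal by recession directions *)
  pose w m := posmx (lam m) *m h m + posmx (- b m) *m N.
  have wE m : w m = posmx (- lam m) *m h m + posmx (b m) *m N.
    apply/eqP; rewrite /w -subr_eq0 opprD addrACA -mulmxBl posmxB -bN.
    by rewrite -mulmxBl -opprB posmxB mulNmx subrr.
  (* s exceeds the total weight of either side, uniformly in m *)
  pose s : R := 1 + \sum_(i < n) \sum_t `|a 0 t|.
  have lams m (p : 'rV[R]_n) : (forall i, p 0 i <= `|lam m 0 i|) -> \sum_i p 0 i < s.
    move=> pl; apply: (@le_lt_trans _ _ (\sum_(i < n) \sum_t `|a 0 t|)); last first.
      by rewrite ltrDr.
    apply: ler_sum => i _; apply: le_trans (pl i) _; rewrite mxE.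
    apply: le_trans (ler_norm_sum _ _ _) _; apply: ler_sum => t _.
    by rewrite normrM ler_piMr.
  have posb (x : R) : Num.max 0 x <= `|x| by rewrite ge_max normr_ge0 ler_norm.
  have wQ m : Q (q + (m.+1%:R / s) *: w m).
    move=> j; have M0 : 0 < m.+1%:R :> R by rewrite ltr0n.
    have NA (x : 'rV[R]_k0) : (forall i, 0 <= x 0 i) -> A j (q + x *m N).
      by move=> x0; apply: NQ.
    have WAj i (c' : 'rV_k) : i != j -> (forall t, 0 <= c' 0 t) ->
        A j (u i + c' *m W i) by apply: WA.
    have [lj|lj] := lerP (lam m 0 j) 0.
      apply: (positive_side_in_member (cA j) WAj c0 NA M0 (hE m)).
      - exact: posmx_ge0.
      - by rewrite mxE max_l.
      - by apply: (lams m) => i; rewrite [posmx _ _ _]mxE.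
      - exact: posmx_ge0.
    rewrite wE; apply: (positive_side_in_member (cA j) WAj c0 NA M0 (hE m)).
    - exact: posmx_ge0.
    - by rewrite mxE max_l // mxE oppr_le0 ltW.
    - apply: (lams m) => i; rewrite [posmx _ _ _]mxE.
      by apply: le_trans (posb _) _; rewrite mxE normrN.
    - exact: posmx_ge0.
  pose wb := posmx (a *m Lb) *m V + posmx (- (a *m Lb *m V *m pinvmx N)) *m N.
  have lamU : entries_cvg U lam (a *m Lb).
    by apply: entries_cvgM => //; exact: entries_cvg_cst.
  have wU : entries_cvg U w wb.
    apply: entries_cvgD.
      by apply: entries_cvgM => //; exact: entries_cvg_posmx.
    apply: entries_cvgM; last exact: entries_cvg_cst.
    apply: entries_cvg_posmx; apply: entries_cvgN.
    apply: entries_cvgM; last exact: entries_cvg_cst.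
    exact: entries_cvgM.
  have s0 : 0 < s.
    by rewrite ltr_wpDr // sumr_ge0 // => i _; rewrite sumr_ge0.
  have : (wb <= N)%MS.
    by apply: NM; exact: (recession_limit oU cQ e0 QD QB wU s0 wQ).
  rewrite submxE mulmxDl -!mulmxA mulmx_coker mulmx0 addr0 => /eqP; exact.
(* with k' = k - k0 and d' = d - k0, the bounds l k' <= d' and
   l >= d' - 2 k' + 3 give (l - 2) (k' - 1) + 1 <= 0 *)
move: blocks; rewrite /l; nia.
Qed.

Theorem theorem1p2 (R : realType) (d k : nat) (hd : (0 < d)%N)
    (hk : (1 <= k <= d)%N) (C : set (set 'rV[R]_d)) (finC : finite_set C)
    (convC : forall A : set 'rV[R]_d, C A ->
       convex_set (A : set (convex_lmodType 'rV[R]_d)))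
    (hC : forall D : set (set 'rV[R]_d), D `<=` C ->
       D #<= `I_(helly_number k d) ->
       contains_cone k (\bigcap_(A in D) A)) :
  contains_cone k (\bigcap_(A in C) A).
Proof.
suff H n (g : nat -> set 'rV[R]_d) : (forall m, (m < n)%N -> C (g m)) ->
    contains_cone k [set x | forall m, (m < n)%N -> g m x].
  have [N /card_esym /card_set_bijP [g [gC _ gs]]] := finC.
  have -> : \bigcap_(A in C) A = [set x | forall m, (m < N)%N -> g m x].
    apply/seteqP; split=> x h; first by move=> m mN; apply: h; apply: gC.
    by move=> A /gs [m mN <-]; apply: h.
  exact: H.
elim: n g => [|n IH] g gC.
  have -> : [set x | forall m, (m < 0)%N -> g m x] = \bigcap_(A in set0) A.
    by rewrite bigcap_set0; apply/seteqP; split.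
  by apply: hC => //; apply: card_ge0.
have [nm|mn] := leqP n.+1 (helly_number k d).
  have -> : [set x | forall m, (m < n.+1)%N -> g m x] =
            \bigcap_(A in g @` `I_n.+1) A by rewrite bigcap_image.
  apply: hC; first by move=> _ [m mn <-]; apply: gC.
  by apply: (card_le_trans (card_image_le _ _)); rewrite card_le_II.
have -> : [set x | forall m, (m < n.+1)%N -> g m x] =
          [set x | forall j : 'I_n.+1, g j x].
  by apply/seteqP; split=> x h => [j|m mn']; [apply: h|apply: (h (Ordinal mn'))].
have [mn1 mn2] : (d.+2 <= n.+1)%N /\ (2 * (d - k + 1) < n.+1)%N.
  by apply/andP; rewrite -gtn_max.
apply: critical_family hk mn1 mn2 _ _ => [j|i].
  by apply: convex_segment_closed; apply: convC; apply: gC.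
(* bump i enumerates the indices other than i *)
have -> : [set x | forall j : 'I_n.+1, i != j -> g j x] =
          [set x | forall m, (m < n)%N -> g (bump i m) x].
  apply/seteqP; split=> x h => [m mn'|j ij].
    by have := h (lift i (Ordinal mn')); apply; exact: neq_lift.
  have [j' -> _] := unlift_some ij; exact: h (ltn_ord j').
apply: IH => m mn'; apply: gC.
by have := ltn_ord (lift i (Ordinal mn')).
Qed.
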